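(* Assume $\mathfrak t=\mathfrak c$ (e.g. CH). Then there exist sets $L_0,L_1\subseteq[\mathbb N]^\infty$ such that, with $L=L_0\cup L_1$: (1) $L_0$ and $L_1$ each satisfy $\mathrm{Split}(B_\Omega,B_\Omega)$ and $\mathrm{Split}(B_\Lambda,B_\Lambda)$; (2) $L$ satisfies $\mathrm{Split}(B_\Lambda,B_\Lambda)$; (3) neither $L_0\times L_1$ nor $L\times L$ satisfies $\mathrm{Split}(C_{\mathrm T^*},C_\Lambda)$; (4) some subset of $L_0\times L_1$ does not satisfy $\mathrm{Split}(C_{\mathrm T},C_{\mathrm T})$. In particular, $\mathrm{Split}(\Lambda,\Lambda)$ and $\mathrm{Split}(\Omega,\Lambda)$ (and their Borel and clopen versions) are not provably closed under finite powers, and $\mathrm{Split}(\Omega,\Omega)$ (and its Borel and clopen versions) is not provably closed under finite products.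
   Context: $[\mathbb N]^\infty$ is the set of infinite subsets of $\mathbb N$, a subspace of $P(\mathbb N)\cong\{0,1\}^{\mathbb N}$; products carry the product topology. A cover of a space $X$ is a family $\mathcal U$ of subsets of $X$ with $\bigcup\mathcal U=X$ such that $X\not\subseteq U$ for all $U\in\mathcal U$. A cover $\mathcal U$ is: a large cover if every $x\in X$ lies in infinitely many members; an $\omega$-cover if every finite subset of $X$ is contained in some member; a $\tau$-cover if it is large and for all $x,y\in X$ at least one of $\{U\in\mathcal U: x\in U, y\notin U\}$, $\{U\in\mathcal U: y\in U, x\notin U\}$ is finite. For a countable cover $\mathcal U=\{U_n\}_{n\in a}$ (bijective enumeration, $a\subseteq\mathbb N$) let $h_{\mathcal U}(x)=\{n\in a:x\in U_n\}$. For $a,b\subseteq\mathbb N$, $a\subseteq^*b$ means $a\setminus b$ is finite. A family $Y$ of infinite subsets of $\mathbb N$ is linearly refinable if for each $y\in Y$ there is an infinite $\hat y\subseteq y$ with $\{\hat y:y\in Y\}$ linearly ordered by $\subseteq^*$; a countable cover $\mathcal U$ is a $\tau^*$-cover if $h_{\mathcal U}[X]$ consists of infinite sets and is linearly refinable. $\Lambda,\Omega$ are the collections of open large covers and open $\omega$-covers; $B_\Lambda,B_\Omega$ the countable Borel large/$\omega$-covers; $C_\Lambda,C_{\mathrm T},C_{\mathrm T^*}$ the countable clopen large covers, $\tau$-covers, $\tau^*$-covers. A space satisfies $\mathrm{Split}(\mathfrak U,\mathfrak V)$ if every $\mathcal U\in\mathfrak U$ can be partitioned into two disjoint subfamilies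 each containing a subfamily belonging to $\mathfrak V$. $\mathfrak t$ is the minimal length $\kappa$ of a sequence $\langle a_\alpha:\alpha<\kappa\rangle$ of infinite subsets of $\mathbb N$, decreasing with respect to $\subseteq^*$, having no infinite $a\subseteq\mathbb N$ with $a\subseteq^* a_\alpha$ for all $\alpha$; $\mathfrak c=2^{\aleph_0}$. *)

(* Defs.v *)
From HB Require Import structures.
From mathcomp Require Import all_boot all_order all_algebra.
From mathcomp Require Import all_classical all_reals all_analysis.
Set Implicit Arguments. Unset Strict Implicit. Unset Printing Implicit Defensive.
Local Open Scope classical_set_scope.
Local Open Scope card_scope.

Definition subset_star (a b : set nat) : Prop := finite_set (a `\` b).

Definition infinite_subsets : set cantor_space :=
  [set x | infinite_set [set n | x n = true]].

(* t = c : there is no tower (a ⊆*-decreasing sequence of infinite sets without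
   infinite pseudo-intersection) whose length is an ordinal of cardinality < c.
   Lengths are represented by strictly well-ordered index types. *)
Definition strict_well_order (I : Type) (lt : I -> I -> Prop) : Prop :=
  (forall i, ~ lt i i) /\
  (forall i j k, lt i j -> lt j k -> lt i k) /\
  (forall i j, lt i j \/ i = j \/ lt j i) /\
  well_founded lt.

Definition t_eq_c : Prop :=
  forall (I : Type) (lt : I -> I -> Prop),
    strict_well_order lt ->
    [set: I] #<= [set: set nat] -> ~ ([set: set nat] #<= [set: I]) ->
    forall a : I -> set nat,
      (forall i, infinite_set (a i)) ->
      (forall i j, lt i j -> subset_star (a j) (a i)) ->
      exists b : set nat, infinite_set b /\ forall i, subset_star b (a i).

Section Covers.
Context {T : topologicalType}.
Implicit Types (X A : set T) (U : set (set T)).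

Definition open_in X A : Prop := exists O, open O /\ A = X `&` O.
Definition clopen_in X A : Prop := open_in X A /\ open_in X (X `\` A).
Definition borel_in X A : Prop := exists B, <<s @open T >> B /\ A = X `&` B.

Definition is_cover X U : Prop :=
  (forall A, U A -> A `<=` X) /\
  (forall x, X x -> exists A, U A /\ A x) /\
  (forall A, U A -> ~ (X `<=` A)).

Definition large_cover X U : Prop :=
  is_cover X U /\ forall x, X x -> infinite_set [set A | U A /\ A x].

Definition omega_cover X U : Prop :=
  is_cover X U /\
  forall F, F `<=` X -> finite_set F -> exists A, U A /\ F `<=` A.

Definition tau_cover X U : Prop :=
  large_cover X U /\
  forall x y, X x -> X y ->
    finite_set [set A | U A /\ A x /\ ~ A y] \/
    finite_set [set A | U A /\ A y /\ ~ A x].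

Definition linearly_refinable (Y : set (set nat)) : Prop :=
  exists r : set nat -> set nat,
    (forall y, Y y -> r y `<=` y /\ infinite_set (r y)) /\
    (forall y z, Y y -> Y z -> subset_star (r y) (r z) \/ subset_star (r z) (r y)).

Definition tau_star_cover X U : Prop :=
  is_cover X U /\
  exists (a : set nat) (f : nat -> set T),
    (forall n m, a n -> a m -> f n = f m -> n = m) /\
    f @` a = U /\
    (forall x, X x -> infinite_set [set n | a n /\ f n x]) /\
    linearly_refinable [set [set n | a n /\ f n x] | x in X].

Definition B_Lambda X U : Prop :=
  countable U /\ (forall A, U A -> borel_in X A) /\ large_cover X U.
Definition B_Omega X U : Prop :=
  countable U /\ (forall A, U A -> borel_in X A) /\ omega_cover X U.
Definition C_Lambda X U : Prop :=
  countable U /\ (forall A, U A -> clopen_in X A) /\ large_cover X U.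
Definition C_T X U : Prop :=
  countable U /\ (forall A, U A -> clopen_in X A) /\ tau_cover X U.
Definition C_Tstar X U : Prop :=
  countable U /\ (forall A, U A -> clopen_in X A) /\ tau_star_cover X U.

Definition Split_prop (P Q : set T -> set (set T) -> Prop) X : Prop :=
  forall U, P X U ->
    exists V W : set (set T),
      V `|` W = U /\ V `&` W = set0 /\
      (exists V', V' `<=` V /\ Q X V') /\
      (exists W', W' `<=` W /\ Q X W').

End Covers.

(* Main.v *)
Require Import Defs.
From mathcomp Require Import all_boot all_order all_algebra.
From mathcomp Require Import all_classical all_reals all_analysis.
Set Implicit Arguments. Unset Strict Implicit. Unset Printing Implicit Defensive.
Local Open Scope classical_set_scope.
Local Open Scope card_scope.

(* Since t = c, intersections of fewer than c comeager sets are comeager.  Along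
   a well-order of type c build pairs (x_j, y_j) such that the sets
   t_j = x_j /\ y_j form a tower generating an ultrafilter: x_j is a Cohen real
   and y_j is Cohen outside x_j \ t', where t' is a pseudo-intersection of the
   earlier t_i deciding the j-th subset of nat.  At stage j also fix a Cohen real
   b_j meant to split the j-th sequence (B_n) of Borel sets.  It splits the
   infinite sets {n | F contained in B_n} for finite sets F of earlier points,
   and later points are generic enough to preserve this for F enlarged by them;
   for the induction one also asks that B_n be nonmeager in finitely many
   prescribed basic open sets.  This yields (1) and (2) for L_0 = {x_j} and
   L_1 = {y_j}.  All x_j and y_j lie in the ultrafilter, so the sets
   U_n = {(x, y) | n in x /\ y} form a tau*-cover of the products, and a
   tau-cover of the diagonal {(x_j, y_j)}; splitting it would split the
   ultrafilter. *)

(** * Towers below the continuum *)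

Lemma finite_natP (A : set nat) :
  finite_set A <-> exists m, forall n, A n -> (n < m)%N.
Proof.
split=> [/finite_seqP[s ->]|[m Am]]; last exact: sub_finite_set Am (finite_II m).
exists (\max_(i <- s) i).+1 => n /= ns; rewrite ltnS.
by rewrite (big_rem n) //= leq_maxl.
Qed.

Definition unbounded (A : set nat) := forall m, exists2 n, (m <= n)%N & A n.

Lemma infinite_natP (A : set nat) : infinite_set A <-> unbounded A.
Proof.
split=> [Ainf m|Aunb /finite_natP[m Am]].
  apply: contrapT => no; apply: Ainf; apply/finite_natP; exists m => n An.
  by rewrite ltnNge; apply/negP => mn; apply: no; exists n.
by have [n mn /Am] := Aunb m; rewrite ltnNge mn.
Qed.

Lemma subset_starP (a b : set nat) :
  subset_star a b <-> exists m, forall n, (m <= n)%N -> a n -> b n.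
Proof.
split=> [/finite_natP[m abm]|[m abm]].
  exists m => n mn an; apply: contrapT => nbn.
  by have := abm n (conj an nbn); rewrite ltnNge mn.
apply/finite_natP; exists m => n [an nbn]; rewrite ltnNge; apply/negP => mn.
exact/nbn/abm.
Qed.

Lemma subset_star_trans (b a c : set nat) :
  subset_star a b -> subset_star b c -> subset_star a c.
Proof.
move=> /subset_starP[m ab] /subset_starP[p bc]; apply/subset_starP.
exists (maxn m p) => n; rewrite geq_max => /andP[mn pn] an.
exact/bc/ab.
Qed.

(** Transfinite recursion in which a stage can be carried out only if all earlier ones succeeded.
    [P i] sees only the values below [i], so a partial function may be padded with [v0]. *)
Lemma wf_dependent_choice (I : Type) (lt : I -> I -> Prop) (V : Type) (v0 : V)
    (P : I -> (I -> V) -> V -> Prop) :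
  well_founded lt ->
  (forall i f g v, (forall j, lt j i -> f j = g j) -> P i f v -> P i g v) ->
  (forall i f, (forall j, lt j i -> P j f (f j)) -> exists v, P i f v) ->
  exists f, forall i, P i f (f i).
Proof.
move=> wf Pext Pstep.
pose ext i (h : forall j, lt j i -> V) j :=
  if pselect (lt j i) is left p then h j p else v0.
pose step i (h : forall j, lt j i -> V) :=
  if pselect (exists v, P i (ext i h) v) is left e then sval (cid e) else v0.
pose f := Fix wf (fun=> V) step.
have fE i : f i = step i (fun j _ => f j).
  rewrite /f Fix_eq // => j g h gh; congr step.
  by apply: functional_extensionality_dep => k; apply/funext => p; exact: gh.
exists f => i; elim/(well_founded_ind wf): i => i IH.
have [v Pv] := Pstep i f IH.
have extf j : lt j i -> f j = ext i (fun j _ => f j) j.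
  by rewrite /ext; case: pselect.
rewrite fE /step; case: pselect => [e|[]]; last first.
  by exists v; exact: Pext Pv.
apply: Pext (svalP (cid e)) => j ji; exact/esym/extf.
Qed.

(** * Sizes below the continuum and a well-order of type continuum *)

Definition embeds (T U : Type) := exists f : T -> U, injective f.

Lemma card_le_setTP (T U : Type) : [set: T] #<= [set: U] <-> embeds T U.
Proof.
split=> [/card_leP[f]|[f finj]].
  exists (fun t => val (f (SigSub (mem_set (I : [set: T] t))))) => s t /val_inj.
  by move=> /(inj (mem_set I) (mem_set I)) [].
have := inj_card_eq (A := [set: T]) (f := f) (fun x y _ _ => @finj x y).
rewrite card_eq_sym => /card_eqPle[le _].
exact: card_le_trans le (card_leT _).
Qed.

Lemma embeds_trans (T U V : Type) : embeds T U -> embeds U V -> embeds T V.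
Proof. by move=> [f fi] [g gi]; exists (g \o f); exact: inj_comp. Qed.

Definition below_continuum (I : Type) :=
  embeds I (set nat) /\ ~ embeds (set nat) I.

Definition segment (I : Type) (lt : I -> I -> Prop) (i : I) := {j | lt j i}.

Definition segment_lt (I : Type) (lt : I -> I -> Prop) (i : I)
  (j k : segment lt i) := lt (sval j) (sval k).

Lemma segment_embeds (I : Type) (lt : I -> I -> Prop) i :
  embeds (segment lt i) I.
Proof. by exists sval; exact: eq_sig_hprop. Qed.

Lemma segment_well_order (I : Type) (lt : I -> I -> Prop) i :
  strict_well_order lt -> strict_well_order (@segment_lt I lt i).
Proof.
move=> [irr [tr [tot wf]]]; split; last split; last split.
- by move=> j; exact: irr.
- by move=> j k l; exact: tr.
- move=> [j ji] [k ki]; have [?|[e|?]] := tot j k; [by left| |by right; right].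
  by right; left; exact: eq_exist.
- move=> [j ji]; elim/(well_founded_ind wf): j ji => j IH ji.
  by apply: Acc_intro => -[k ki] kj; exact: IH.
Qed.

Lemma below_continuum_segment (I : Type) (lt : I -> I -> Prop) i :
  below_continuum I -> below_continuum (segment lt i).
Proof.
move=> [Ic cI]; split; first exact: embeds_trans (segment_embeds lt i) Ic.
by move=> ci; apply/cI/(embeds_trans ci)/segment_embeds.
Qed.

(** Well-order [set nat]. If some proper initial segment has the size of the continuum, the least
    such segment is taken, otherwise the whole order; all segments of the result are then
    smaller. *)
Lemma exists_continuum_order : exists (J : choiceType) (lt : J -> J -> Prop),
  [/\ strict_well_order lt, embeds (set nat) J &
      forall j, below_continuum (segment lt j)].
Proof.
have [R Rwo] := @wochoice.well_ordering_principle (set nat).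
have Rmin (P : set (set nat)) : P !=set0 ->
    exists z, [/\ P z, forall x, P x -> R z x &
      forall y, P y -> (forall x, P x -> R y x) -> z = y].
  move=> [x Px]; have [|z [[Pz zmin] zuniq]] := Rwo (mem P).
    by exists x; rewrite inE.
  exists z; split=> [|y Py|y Py ymin]; first by rewrite inE in Pz.
    by apply: zmin; rewrite inE.
  by apply: zuniq; split=> [|w]; rewrite inE //; exact: ymin.
have Rtot x y : R x y \/ R y x.
  have [|z [[-> zmin|-> zmin] _]] := Rmin [set z | z = x \/ z = y].
  - by exists x; left.
  - by left; apply: zmin; right.
  - by right; apply: zmin; left.
have Rrefl x : R x x by have [] := Rtot x x.
have Ranti x y : R x y -> R y x -> x = y.
  move=> xy yx; have [|z [_ _ zuniq]] := Rmin [set z | z = x \/ z = y].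
    by exists x; left.
  rewrite -(zuniq x) ?(zuniq y) //; [by right| |by left|];
    by move=> w [->|->].
have Rtr x y z : R x y -> R y z -> R x z.
  move=> xy yz; have [|w [[->|[->|->]] wmin _]] :=
    Rmin [set w | w = x \/ w = y \/ w = z]; first by exists x; left.
  - by apply: wmin; right; right.
  - by rewrite (Ranti x y) //; apply: wmin; left.
  - by rewrite -(Ranti y z) //; apply: wmin; right; left.
pose lt x y := R x y /\ x <> y.
have ltwo : strict_well_order lt.
  split; last split; last split.
  - by move=> x [].
  - move=> x y z [xy nxy] [yz nyz]; split; first exact: Rtr yz.
    by move=> e; subst z; exact/nxy/Ranti.
  - move=> x y; have [->|nxy] := pselect (x = y); first by right; left.
    have [xy|yx] := Rtot x y; [by left|right; right].
    by split=> // e; apply: nxy.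
  - move=> x; apply: contrapT => nacc.
    have [|z [zacc zmin _]] := Rmin [set z | ~ Acc lt z]; first by exists x.
    apply: zacc; apply: Acc_intro => y [yz nyz]; apply: contrapT => nyacc.
    exact/nyz/Ranti/zmin.
have [[j cj]|no] := pselect (exists j, embeds (set nat) (segment lt j)).
  have [|k [ck kmin _]] := Rmin [set j | embeds (set nat) (segment lt j)].
    by exists j.
  exists {classic segment lt k}, (@segment_lt _ lt k); split.
  - exact: segment_well_order.
  - exact: ck.
  move=> [i ik]; split.
    apply: embeds_trans (segment_embeds _ _) _; exact: segment_embeds.
  move=> ci; have [Rik nik] := ik; apply: nik; apply: Ranti Rik _.
  apply: kmin; apply: embeds_trans ci _.
  exists (fun j : segment (@segment_lt _ lt k) (exist _ i ik) =>
    exist (lt^~ i) (sval (sval j)) (svalP j)) => -[[a ak] ai] [[b bk] bi].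
  move=> /= [ab]; subst b; apply: eq_exist => //; exact: eq_exist.
exists (set nat), lt; split; [exact: ltwo|by exists id|].
move=> i; split; first exact: segment_embeds.
by move=> ci; apply: no; exists i.
Qed.

Lemma tower_lower_bound (I : Type) (lt : I -> I -> Prop) (a : I -> set nat) :
  t_eq_c -> strict_well_order lt -> below_continuum I ->
  (forall i, unbounded (a i)) ->
  (forall i j, lt i j -> subset_star (a j) (a i)) ->
  exists b, unbounded b /\ forall i, subset_star b (a i).
Proof.
move=> tc wo [Ic cI] ainf adec.
have [|||b [binf ba]] := tc I lt wo _ _ a _ adec.
- exact/card_le_setTP.
- by move/card_le_setTP.
- by move=> i; apply/infinite_natP.
- by exists b; split=> //; apply/infinite_natP.
Qed.

(** Build a descending sequence meeting one requirement per step, taking a lower bound of the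
    earlier elements before each step and of the whole sequence at the end. [Q i] is not assumed to
    pass to smaller elements, so [s] is only placed below witnesses. *)
Lemma meet_requirements (S : Type) (le : S -> S -> Prop) (s0 : S) :
  (forall x y z, le x y -> le y z -> le x z) ->
  (forall (I : Type) (lt : I -> I -> Prop),
    strict_well_order lt -> below_continuum I ->
    forall a : I -> S, (forall i j, lt i j -> le (a j) (a i)) ->
    exists s, forall i, le s (a i)) ->
  forall (I : Type) (lt : I -> I -> Prop),
    strict_well_order lt -> below_continuum I ->
  forall Q : I -> S -> Prop, (forall i s, exists2 s', le s' s & Q i s') ->
  exists s, forall i, exists2 s', le s s' & Q i s'.
Proof.
move=> letr lb I lt wo Ic Q Qdense.
have [irr [tr [tot wf]]] := wo.
pose P i (f : I -> S) s := Q i s /\ forall j, lt j i -> le s (f j).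
have [i f g s fg [Qs sf]|i f Pf|f fP] := @wf_dependent_choice I lt S s0 P wf.
- by split=> // j ji; rewrite -fg //; exact: sf.
- have [|||s sP] := lb (segment lt i) (@segment_lt _ lt i) _ _ (fun j => f (sval j)).
  + exact: segment_well_order.
  + exact: below_continuum_segment.
  + by move=> [j ji] [k ki] jk; apply: (Pf k ki).2.
  + have [s' s's Qs'] := Qdense i s; exists s'; split=> // j ji.
    by apply: letr s's _; exact: (sP (exist _ j ji)).
have [|s sf] := lb I lt wo Ic f; first by move=> i j; apply: (fP j).2.
by exists s => i; exists (f i); [exact: sf|exact: (fP i).1].
Qed.

(* Build a tower whose i-th set has gaps outgrowing f i; g n is the second
   element after n of a pseudo-intersection. *)
Lemma dominating_below_continuum (I : Type) (lt : I -> I -> Prop)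
    (f : I -> nat -> nat) :
  t_eq_c -> strict_well_order lt -> below_continuum I ->
  exists g : nat -> nat,
    forall i, exists m, forall n, (m <= n)%N -> (f i n <= g n)%N.
Proof.
move=> tc wo Ic.
pose S := {a : set nat | unbounded a}.
have natS : unbounded [set: nat] by move=> m; exists m.
pose Q i (a : S) := forall p q, sval a p -> sval a q -> (p < q)%N ->
  forall n, (n <= p)%N -> (f i n <= q)%N.
have [|||a aP] := @meet_requirements S (fun a b => subset_star (sval a) (sval b))
    (exist _ _ natS) _ _ I lt wo Ic Q.
- by move=> a b c; exact: subset_star_trans.
- move=> K ltK woK Kc a adec.
  have [|b [binf ba]] := tower_lower_bound tc woK Kc (a := fun i => sval (a i)) _ adec.
    by move=> i; exact: svalP.
  by exists (exist _ b binf).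
- move=> i [a aunb].
  (* [F] makes [h] so sparse that [h k.+1] bounds [f i] on all arguments up to [h k]. *)
  pose F p := maxn p.+1 (\max_(n < p.+1) f i n).
  have /choice[next nextP] : forall m, exists n, (m <= n)%N /\ a n.
    by move=> m; have [n mn an] := aunb m; exists n.
  pose h k := iter k (fun p => next (F p)) (next 0%N).
  have hS k : (F (h k) <= h k.+1)%N by exact: (nextP _).1.
  have hlt : {homo h : k l / (k < l)%N}.
    apply: homo_ltn => [y x z|k]; first exact: ltn_trans.
    exact: leq_trans (leq_maxl _ _) (hS k).
  have hle := ltnW_homo hlt.
  have hunb : unbounded (range h).
    move=> m; exists (h m); last by exists m.
    elim: m => // m IH; exact: leq_ltn_trans IH (hlt _ _ (ltnSn m)).
  exists (exist _ _ hunb).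
    apply/subset_starP; exists 0%N => _ _ [[|k] _ <-]; exact: (nextP _).2.
  move=> _ _ [k _ <-] [l _ <-] kl n nk.
  have {}kl : (k < l)%N by rewrite ltnNge; apply: contraL kl => /hle; rewrite -leqNgt.
  apply: leq_trans (leq_trans (hS k) (hle _ _ kl)).
  apply: leq_trans (leq_maxr _ _).
  by rewrite -(@inordK (h k) n) ?ltnS //; exact: (leq_bigmax (inord n)).
have /choice[g gP] : forall n, exists q, exists p,
    [/\ (n <= p)%N, (p < q)%N, sval a p & sval a q].
  move=> n; have [p np ap] := svalP a n; have [q pq aq] := svalP a p.+1.
  by exists q, p.
exists g => i; have [s /subset_starP[m am] Qs] := aP i.
exists m => n mn; have [p [np pg ap ag]] := gP n.
have mp := leq_trans mn np.
by apply: Qs np => //; apply: am => //; apply: leq_trans mp (ltnW pg).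
Qed.

(** * Comeager sets of sequences *)

Definition dense_strings (A : Type) (D : set (seq A)) :=
  forall s, exists u, D (s ++ u).

Definition extensions (A : Type) (D : set (seq A)) : set (seq A) :=
  [set t | exists p u, t = p ++ u /\ D p].

Definition almost_sub (A : countType) (D E : set (seq A)) :=
  exists m, forall t, (m <= pickle t)%N -> D t -> E t.

Lemma almost_sub_trans (A : countType) (D E F : set (seq A)) :
  almost_sub D E -> almost_sub E F -> almost_sub D F.
Proof.
move=> [m DE] [p EF]; exists (maxn m p) => t; rewrite geq_max => /andP[mt pt] Dt.
exact/EF/DE.
Qed.

(** Only finitely many strings have code below [m]; [l] exceeds all their lengths. *)
Lemma pickle_size (A : countType) m :
  exists l, forall t : seq A, (l <= size t)%N -> (m <= pickle t)%N.
Proof.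
elim: m => [|m [l lP]]; first by exists 0%N.
exists (maxn l (size (odflt [::] (unpickle m : option (seq A)))).+1) => t.
rewrite geq_max => /andP[/lP mt lt]; rewrite ltn_neqAle mt andbT.
by apply: contraL lt => /eqP ->; rewrite pickleK /= ltnn.
Qed.

Lemma dense_pickle (A : countType) (a0 : A) (D : set (seq A)) s m :
  dense_strings D -> exists u, D (s ++ u) /\ (m <= pickle (s ++ u))%N.
Proof.
move=> Dd; have [l lP] := pickle_size A m.
have [u Du] := Dd (s ++ nseq l a0); exists (nseq l a0 ++ u); rewrite catA.
by split=> //; apply: lP; rewrite !size_cat size_nseq addnAC leq_addl.
Qed.

(* Pseudo-intersect the tower inside each cone, then discard from the cone of s
   an initial part whose length dominates what each a i requires. *)
Lemma dense_tower_lower_bound (A : countType) (a0 : A)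
    (I : Type) (lt : I -> I -> Prop) (a : I -> set (seq A)) :
  t_eq_c -> strict_well_order lt -> below_continuum I ->
  (forall i, dense_strings (a i)) ->
  (forall i j, lt i j -> almost_sub (a j) (a i)) ->
  exists b, dense_strings b /\ forall i, almost_sub b (a i).
Proof.
move=> tc wo Ic ad adec.
(* An index [i0] is needed to see that the large members of [b s] code strings extending [s]. *)
have [[i0 _]|noI] := pselect (exists i : I, True); last first.
  exists setT; split=> [s|i]; first by exists [::].
  by case: noI; exists i.
pose cone i (s : seq A) : set nat :=
  [set n | exists2 u, n = pickle (s ++ u) & a i (s ++ u)].
have coneunb i s : unbounded (cone i s).
  move=> m; have [u [au mu]] := dense_pickle a0 s m (ad i).
  by exists (pickle (s ++ u)) => //; exists u.
have conedec s i j : lt i j -> subset_star (cone j s) (cone i s).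
  move=> /adec[m ma]; apply/subset_starP; exists m => n mn [u nE au].
  by exists u => //; apply: ma => //; rewrite -nE.
have /choice[b bP] : forall s, exists b, unbounded b /\
    forall i, subset_star b (cone i s).
  move=> s; exact: tower_lower_bound tc wo Ic (coneunb^~ s) (conedec s).
have /choice[f fP] : forall i, exists f, forall k : nat, forall n,
    (f k <= n)%N -> let s := odflt [::] (unpickle k) in b s n -> cone i s n.
  move=> i; have /choice[f fP] : forall k : nat, exists m, forall n, (m <= n)%N ->
      let s := odflt [::] (unpickle k) in b s n -> cone i s n.
    by move=> k; apply/subset_starP; exact: (bP _).2.
  by exists f.
have fP' i s n : (f i (pickle s) <= n)%N -> b s n -> cone i s n.
  by move=> /fP; rewrite pickleK.
have [g gP] := dominating_below_continuum f tc wo Ic.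
exists [set t | exists s, (g (pickle s) <= pickle t)%N /\ b s (pickle t)].
split=> [s|i].
  have [n] := (bP s).1 (maxn (f i0 (pickle s)) (g (pickle s))).
  rewrite geq_max => /andP[fn gn] bn; have [u nE au] := fP' _ _ _ fn bn.
  by exists u, s; rewrite -nE.
have [m mP] := gP i; exists (\max_(k < m) f i k) => t tm [s [gt bt]].
have [u /(pcan_inj pickleK) -> //] : cone i s (pickle t).
(* Codes of [s] from [m] on are handled by domination, the finitely many smaller ones by the size of
   the code of [t]. *)
apply: fP' => //; have [ms|sm] := leqP m (pickle s).
  exact: leq_trans (mP _ ms) gt.
by apply: leq_trans tm; exact: (leq_bigmax (Ordinal sm)).
Qed.

(** Closing [D i] under extensions makes its intersection with any dense set dense again, so each
    [extensions (D i)] is a requirement that can be met below every dense set. *)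
Lemma dense_pseudo_intersection (A : countType) (a0 : A)
    (I : Type) (lt : I -> I -> Prop) (D : I -> set (seq A)) :
  t_eq_c -> strict_well_order lt -> below_continuum I ->
  (forall i, dense_strings (D i)) ->
  exists b, dense_strings b /\ forall i, almost_sub b (extensions (D i)).
Proof.
move=> tc wo Ic Dd.
pose S := {b : set (seq A) | dense_strings b}.
have dT : dense_strings [set: seq A] by move=> s; exists [::].
have [|||[b bd] bP] := @meet_requirements S (fun b c => almost_sub (sval b) (sval c))
    (exist _ _ dT) _ _ I lt wo Ic (fun i b => sval b `<=` extensions (D i)).
- by move=> b c d; exact: almost_sub_trans.
- move=> K ltK woK Kc b bdec.
  have [c [cd cb]] :=
    dense_tower_lower_bound a0 tc woK Kc (fun i => svalP (b i)) bdec.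
  by exists (exist _ c cd).
- move=> i [c cd].
  have dI : dense_strings (c `&` extensions (D i)).
    move=> s; have [u Du] := Dd i s; have [v cv] := cd (s ++ u).
    by exists (u ++ v); rewrite catA; split=> //; exists (s ++ u), v.
  by exists (exist _ _ dI) => [|t []] //; exists 0%N => t _ [].
exists b; split=> // i; have [[c cd] bc cD] := bP i.
by apply: almost_sub_trans bc _; exists 0%N => t _ /cD.
Qed.

(** * Comeager sets and the Baire category theorem *)

Definition visits (A : Type) (x : nat -> A) (D : set (seq A)) :=
  exists k, D (mkseq x k).

(* In the product topology this says that G contains a dense G_delta. *)
Definition comeager (A : Type) (G : set (nat -> A)) :=
  exists C : nat -> set (seq A), (forall n, dense_strings (C n)) /\
    forall x, (forall n, visits x (C n)) -> G x.

Lemma mkseq_cat (A : Type) (x : nat -> A) k l :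
  mkseq x (k + l) = mkseq x k ++ mkseq (fun n => x (k + n)%N) l.
Proof. by rewrite /mkseq iotaD map_cat add0n -[X in iota X l]addn0 iotaDl -map_comp. Qed.

Lemma mkseq_catP (A : Type) (x : nat -> A) k p u :
  mkseq x k = p ++ u -> mkseq x (size p) = p.
Proof.
move=> e; have := congr1 size e; rewrite size_mkseq size_cat => kE.
move/(congr1 (take (size p))): e.
by rewrite kE mkseq_cat !take_size_cat ?size_mkseq.
Qed.

Lemma comeagerW (A : Type) (G H : set (nat -> A)) :
  G `<=` H -> comeager G -> comeager H.
Proof. by move=> GH [C [Cd CG]]; exists C; split=> // x /CG/GH. Qed.

Lemma comeager_visits (A : Type) (D : set (seq A)) :
  dense_strings D -> comeager [set x | visits x D].
Proof. by move=> Dd; exists (fun=> D); split=> // x /(_ 0%N). Qed.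

Lemma comeager_countable_bigcap (A : Type) (K : countType)
    (G : K -> set (nat -> A)) :
  (forall k, comeager (G k)) -> comeager [set x | forall k, G k x].
Proof.
move=> /choice[C CG].
exists (fun n => if unpickle n is Some (k, m) then C k m else setT); split.
  by move=> n; case: unpickle => [[k m]|]; [exact: (CG k).1|move=> s; exists [::]].
move=> x xC k; apply: (CG k).2 => m.
by have := xC (pickle (k, m)); rewrite pickleK.
Qed.

Lemma comeagerI (A : Type) (G H : set (nat -> A)) :
  comeager G -> comeager H -> comeager (G `&` H).
Proof.
move=> Gc Hc; have := @comeager_countable_bigcap A bool (fun b => if b then G else H).
move=> /(_ _)/(comeagerW _); apply; last by case.
by move=> x GH; split; [exact: GH true|exact: GH false].
Qed.

Lemma comeagerT (A : Type) : comeager [set: nat -> A].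
Proof. by exists (fun=> setT); split=> // n s; exists [::]. Qed.

(** The Baire category argument: starting from [s], enter [C n] at step [n]. The entry [a0] appended
    at each step makes the lengths tend to infinity, so the limit is a total sequence. *)
Lemma comeager_in_cylinder (A : Type) (a0 : A) (G : set (nat -> A)) s :
  comeager G -> exists x, G x /\ mkseq x (size s) = s.
Proof.
move=> [C [Cd CG]].
have /choice[next nextP] : forall nt : nat * seq A,
    exists u, C nt.1 (rcons nt.2 a0 ++ u) by move=> nt; exact: Cd.
pose fix t n := if n is m.+1 then rcons (t m) a0 ++ next (m, t m) else s.
have tmono m n : exists u, t (m + n)%N = t m ++ u.
  elim: n => [|n [u tu]]; first by exists [::]; rewrite addn0 cats0.
  by rewrite addnS /= tu -cats1 -!catA; eexists.
have tsize n : (n <= size (t n))%N.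
  elim: n => //= n IH; rewrite size_cat size_rcons addSn ltnS.
  exact: leq_trans IH (leq_addr _ _).
pose x n := nth a0 (t n.+1) n.
have xt n : mkseq x (size (t n)) = t n.
  apply: (@eq_from_nth _ a0); rewrite size_mkseq // => i it; rewrite nth_mkseq // /x.
  have [ni|/ltnW/subnKC ni] := leqP n i.+1.
    by have [u] := tmono n (i.+1 - n)%N; rewrite subnKC // => ->; rewrite nth_cat it.
  have [u] := tmono i.+1 (n - i.+1)%N; rewrite ni => ->.
  by rewrite nth_cat (tsize i.+1).
exists x; split; last exact: (xt 0%N).
by apply: CG => n; exists (size (t n.+1)); rewrite xt; exact: (nextP (n, t n)).
Qed.

(** Since every [phi n] is onto, an extension of the image of a string lifts coordinate by
    coordinate. This lets two reals be read off one generic sequence of pairs. *)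
Lemma comeager_preimage (A B : Type) (a0 : A) (phi : nat -> A -> B)
    (G : set (nat -> B)) :
  (forall n b, exists a, phi n a = b) ->
  comeager G -> comeager [set x | G (fun n => phi n (x n))].
Proof.
move=> surj [C [Cd CG]].
have /choice[psi psiK] : forall nb : nat * B, exists a, phi nb.1 a = nb.2.
  by move=> nb; exact: surj.
pose tr s := mkseq (fun n => phi n (nth a0 s n)) (size s).
exists (fun n => [set s | C n (tr s)]); split=> [n s|x xC].
  have [u Cu] := Cd n (tr s); set t := tr s ++ u in Cu.
  exists (mkseq (fun i => psi (size s + i, nth (phi 0%N a0) u i)%N) (size u)).
  suff trE : tr (s ++ mkseq (fun i => psi (size s + i, nth (phi 0 a0) u i)%N)
      (size u)) = t by rewrite /mkset trE.
  rewrite /tr size_cat size_mkseq mkseq_cat; congr (_ ++ _).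
    apply: (@eq_from_nth _ (phi 0%N a0)); rewrite !size_mkseq // => i is_.
    by rewrite !nth_mkseq // nth_cat is_.
  apply: (@eq_from_nth _ (phi 0%N a0)); rewrite !size_mkseq // => i iu.
  rewrite !nth_mkseq // nth_cat ltnNge leq_addr /= addKn nth_mkseq //.
  exact: psiK (_, _).
apply: CG => n; have [k Ck] := xC n; exists k.
suff trE : tr (mkseq x k) = mkseq (fun n => phi n (x n)) k.
  by rewrite -trE.
apply: (@eq_from_nth _ (phi 0%N a0)); rewrite !size_mkseq // => i ik.
by rewrite !nth_mkseq // ?size_mkseq // nth_mkseq.
Qed.

(** * Additivity of the comeager filter *)

Definition comeager_additive (K : Type) :=
  forall (A : countType) (a0 : A) (G : K -> set (nat -> A)),
  (forall k, comeager (G k)) -> comeager [set x | forall k, G k x].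

Lemma countable_comeager_additive (K : countType) : comeager_additive K.
Proof. by move=> A _ G; exact: comeager_countable_bigcap. Qed.

Lemma comeager_additiveX (K L : Type) :
  comeager_additive K -> comeager_additive L -> comeager_additive (K * L).
Proof.
move=> Ka La A a0 G Gc.
have := Ka A a0 (fun k => [set x | forall l, G (k, l) x]).
move=> /(_ (fun k => La A a0 _ (fun l => Gc (k, l)))).
by apply: comeagerW => x Gx [k l]; exact: Gx.
Qed.

Lemma comeager_additive_seq (K : Type) :
  comeager_additive K -> comeager_additive (seq K).
Proof.
move=> Ka A a0 G Gc.
suff Gn n : forall G : seq K -> set (nat -> A), (forall s, comeager (G s)) ->
    comeager [set x | forall s, size s = n -> G s x].
  have := comeager_countable_bigcap (fun n => Gn n G Gc).
  by apply: comeagerW => x Gx s; exact: Gx.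
elim: n => [|n IH] {Gc}G Gc.
  by apply: comeagerW (Gc [::]) => x Gx [].
have := Ka A a0 _ (fun k => IH (fun s => G (k :: s)) (fun s => Gc (k :: s))).
by apply: comeagerW => x Gx [//|k s] [/Gx].
Qed.

(** For each [n] one dense set [a n] is almost contained in all [extensions (C i n)]. Visiting it at
    strings of arbitrarily large code gets past the finitely many exceptions of each [i]. *)
Lemma below_continuum_comeager_additive (I : Type) (lt : I -> I -> Prop) :
  t_eq_c -> strict_well_order lt -> below_continuum I -> comeager_additive I.
Proof.
move=> tc wo Ic A a0 G /choice[C CG].
have /choice[a aP] : forall n, exists a, dense_strings a /\
    forall i, almost_sub a (extensions (C i n)).
  by move=> n; apply: dense_pseudo_intersection tc wo Ic _ => // i; apply: (CG i).1.
pose D (nm : nat * nat) : set (seq A) :=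
  [set t | a nm.1 t /\ (nm.2 <= pickle t)%N].
have Dc nm : comeager [set x | visits x (D nm)].
  apply: comeager_visits => s.
  by have [u [au mu]] := dense_pickle a0 s nm.2 (aP nm.1).1; exists u.
apply: comeagerW (comeager_countable_bigcap Dc) => x xa i.
apply: (CG i).2 => n; have [m am] := (aP n).2 i.
have [k [/= ak mk]] := xa (n, m); have [p [u [e Cp]]] := am _ mk ak.
by exists (size p); rewrite (mkseq_catP e).
Qed.

(** * Borel sets and forcing by finite strings *)

Definition cylinder (A : Type) (s : seq A) : set (nat -> A) :=
  [set x | mkseq x (size s) = s].

Lemma cylinder_mkseq (A : Type) (x : nat -> A) k : cylinder (mkseq x k) x.
Proof. by rewrite /cylinder /= size_mkseq. Qed.

Lemma cylinder_cat (A : Type) (s u : seq A) : cylinder (s ++ u) `<=` cylinder s.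
Proof. by move=> x /mkseq_catP. Qed.

Lemma cylinder_compatible (A : Type) (s t : seq A) x :
  cylinder s x -> cylinder t x -> exists u v, s ++ u = t ++ v.
Proof.
move=> sx tx; exists (mkseq (fun n => x (size s + n)%N) (size t)).
exists (mkseq (fun n => x (size t + n)%N) (size s)).
by rewrite -{1}sx -{2}tx -!mkseq_cat addnC.
Qed.

(** [G] is comeager in the cylinder of [s]: the forcing relation for one Cohen real. *)
Definition forces (s : seq bool) (G : set (nat -> bool)) :=
  comeager [set x | cylinder s x -> G x].

(** For [G] with the Baire property this says that [G] is nonmeager in the cylinder of [s]. *)
Definition forceable (s : seq bool) (G : set (nat -> bool)) :=
  exists u, forces (s ++ u) G.

(* Equivalent to the Baire property. *)
Definition decided (G : set (nat -> bool)) :=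
  forall s, forceable s G \/ forceable s (~` G).

Lemma forcesW s (G H : set (nat -> bool)) : G `<=` H -> forces s G -> forces s H.
Proof. by move=> GH; apply: comeagerW => x Gx /Gx/GH. Qed.

(** The strings that extend [s] and force [G], or are incompatible with [s], are dense; so a generic
    [x] in the cylinder of [s] visits one that forces [G]. As there are countably many strings, a
    generic [x] obeys all these forcing statements at once. *)
Lemma dense_forceable_forces s G :
  (forall u, forceable (s ++ u) G) -> forces s G.
Proof.
move=> sG.
pose D : set (seq bool) := [set t |
  (exists2 u, t = s ++ u & forces t G) \/ ~ exists u v, s ++ u = t ++ v].
have Dd : dense_strings D.
  move=> t; have [[u [v e]]|no] := pselect (exists u v, s ++ u = t ++ v).
    have [w wG] := sG u; exists (v ++ w); left; exists (u ++ w).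
      by rewrite catA -e catA.
    by rewrite catA -e.
  by exists [::]; right; rewrite cats0.
have Fc : comeager [set x | forall t, cylinder t x -> forces t G -> G x].
  apply: comeager_countable_bigcap => t.
  have [tG|ntG] := pselect (forces t G).
    by apply: comeagerW tG => x tGx /tGx.
  by apply: comeagerW (comeagerT bool).
apply: comeagerW (comeagerI (comeager_visits Dd) Fc) => x [[k Dx] xF] sx.
case: Dx => [[u _ xG]|[]]; first exact: xF (cylinder_mkseq x k) xG.
exact: cylinder_compatible sx (cylinder_mkseq x k).
Qed.

Lemma not_forceable_forcesC s G :
  decided G -> ~ forceable s G -> forces s (~` G).
Proof.
move=> Gd nG; apply: dense_forceable_forces => u.
have [[v vG]|//] := Gd (s ++ u).
by case: nG; exists (u ++ v); rewrite catA.
Qed.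

Lemma decidedC G : decided G -> decided (~` G).
Proof. by move=> Gd s; rewrite setCK; case: (Gd s) => H; [right|left]. Qed.

(** If no [G n] can be forced below [s], then [s] forces every complement, hence the countable
    intersection of the complements. *)
Lemma decided_bigcup (G : nat -> set (nat -> bool)) :
  (forall n, decided (G n)) -> decided (\bigcup_n G n).
Proof.
move=> Gd s; have [[n [u uG]]|no] := pselect (exists n, forceable s (G n)).
  by left; exists u; apply: forcesW uG => x Gx; exists n.
right; exists [::]; rewrite cats0.
have : comeager [set x | forall n, cylinder s x -> (~` G n) x].
  apply: comeager_countable_bigcap => n; apply: not_forceable_forcesC => // sG.
  by apply: no; exists n.
by apply: comeagerW => x xG sx [n _ /xG]; apply.
Qed.

Lemma decided_cylinder t : decided (cylinder t).
Proof.
move=> s; have [[u [v e]]|no] := pselect (exists u v, s ++ u = t ++ v).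
  left; exists u; apply: comeagerW (comeagerT bool) => x _.
  by rewrite e => /cylinder_cat.
right; exists [::]; rewrite cats0; apply: comeagerW (comeagerT bool) => x _ sx tx.
exact/no/cylinder_compatible/tx.
Qed.

(** * Codes for Borel sets *)

Inductive borel_code :=
| BaseCode of seq bool
| ComplCode of borel_code
| UnionCode of (nat -> borel_code).

Fixpoint denote (c : borel_code) : set (nat -> bool) :=
  match c with
  | BaseCode s => cylinder s
  | ComplCode d => ~` denote d
  | UnionCode f => \bigcup_n denote (f n)
  end.

Lemma decided_denote c : decided (denote c).
Proof.
elim: c => [s|c IH|f IH] /=; first exact: decided_cylinder.
  exact: decidedC.
exact: decided_bigcup.
Qed.

(* The node labels of the well-founded tree c, listed by branch. *)
Fixpoint labels (c : borel_code) (p : seq nat) : nat :=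
  match c, p with
  | BaseCode s, _ => (pickle s).+2
  | ComplCode _, [::] => 0
  | ComplCode d, _ :: q => labels d q
  | UnionCode _, [::] => 1
  | UnionCode f, n :: q => labels (f n) q
  end.

(** This bounds the number of codes by the continuum, so that all of them can be listed along a
    well-order of that type. The label at the empty path reveals the constructor, and longer paths
    recover the subtrees. *)
Lemma labels_inj : injective labels.
Proof.
elim=> [s|c IH|f IH] [t|d|g] e; have := congr1 (@^~ [::]) e => //=.
- by move=> [] /(pcan_inj pickleK) ->.
- move=> _; congr ComplCode; apply: IH; apply/funext => p.
  exact: (congr1 (@^~ (0 :: p)%N) e).
- move=> _; congr UnionCode; apply/funext => n; apply: IH; apply/funext => p.
  exact: (congr1 (@^~ (n :: p)) e).
Qed.

Lemma embeds_set_countable (K : countType) : embeds (set K) (set nat).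
Proof.
exists (fun A => [set pickle k | k in A]) => A B e; apply/seteqP; split=> k Ak.
  have : [set pickle k | k in B] (pickle k) by rewrite -e; exists k.
  by move=> [l Bl /(pcan_inj pickleK) <-].
have : [set pickle k | k in A] (pickle k) by rewrite e; exists k.
by move=> [l Bl /(pcan_inj pickleK) <-].
Qed.

(** Otherwise points outside [O] agreeing with [x] on longer and longer prefixes would converge to
    [x]. *)
Lemma open_cylinder (O : set cantor_space) (x : cantor_space) :
  open O -> O x -> exists k, cylinder (mkseq x k) `<=` O.
Proof.
move=> oO Ox; apply: contrapT => no.
have /choice[y yP] : forall k, exists y, cylinder (mkseq x k) y /\ ~ O y.
  move=> k; apply: contrapT => noy; apply: no; exists k => z zk.
  by apply: contrapT => nOz; apply: noy; exists z.
have yx : (y : nat -> cantor_space) @ \oo --> x.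
  apply/cvg_sup => n U [_ [[V oV <-] Vx VU]]; exists n.+1 => // k /= nk.
  apply: VU; have [yk _] := yP k; suff e : x n = y k n by move: Vx; rewrite /= e.
  have := congr1 (fun s => nth false s n) yk.
  by rewrite size_mkseq !nth_mkseq.
have [|N _ HN] := yx O; first exact: open_nbhs_nbhs.
exact: (yP N).2 (HN N (leqnn N)).
Qed.

Lemma borel_denote (B : set cantor_space) :
  <<s @open cantor_space >> B -> exists c, B = denote c.
Proof.
suff : <<s @open cantor_space >> `<=` [set B | exists c, B = denote c] by apply.
apply: smallest_sub => [|O oO].
  split=> [|_ [c ->]|F /choice[f Ff]].
  - exists (ComplCode (BaseCode [::])) => /=.
    by rewrite -setCT; congr (~` _); apply/seteqP; split.
  - by exists (ComplCode c); rewrite setTD.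
  - by exists (UnionCode f) => /=; congr bigcup; apply/funext.
(* An open set is the union of the cylinders inside it; all other indices get a code of the empty
   set. *)
pose f n := if unpickle n is Some s then
  if `[< cylinder s `<=` O >] then BaseCode s else ComplCode (BaseCode [::])
  else ComplCode (BaseCode [::]).
exists (UnionCode f); apply/seteqP; split=> [x Ox|x [n _]].
  have [k kO] := open_cylinder oO Ox; exists (pickle (mkseq x k)) => //.
  by rewrite /f pickleK asboolT //; exact: cylinder_mkseq.
rewrite /f; case: unpickle => [s|]; last by case.
by case: asboolP => [sO /sO|_ []].
Qed.

(** For Borel [B n] the second clause asks that [B n] be nonmeager in each cylinder listed in [Os],
    which leaves room for generic points to enter [B n] later. *)
Definition potential (B : nat -> set (nat -> bool)) (E : set nat)
    (Os : seq (seq bool)) : set nat :=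
  [set n | E n /\ forall s, s \in Os -> forceable s (B n)].

(* Once x belongs to the n-th set it cannot lie in a cylinder forcing the
   contrary, so an infinite E `&` [set n | B n x] makes all the restrictions of
   E to neighbourhoods of x infinite; these meet b in arbitrarily large n, and
   by genericity some such n is realised by x. *)
Lemma comeager_preserves_splitting (B : nat -> set (nat -> bool)) (E b : set nat) :
  (forall n, decided (B n)) ->
  (forall Os, unbounded (potential B E Os) -> unbounded (potential B E Os `&` b)) ->
  comeager [set x | forall Os,
    unbounded (potential B E Os `&` [set n | B n x]) ->
    unbounded (potential B E Os `&` [set n | B n x] `&` b)].
Proof.
move=> Bd Eb; apply: comeager_countable_bigcap => Os.
have c1 : comeager [set x | forall ns : nat * seq bool,
    cylinder ns.2 x -> B ns.1 x -> forceable ns.2 (B ns.1)].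
  apply: comeager_countable_bigcap => -[n s] /=.
  have [sB|nsB] := pselect (forceable s (B n)).
    by apply: comeagerW (comeagerT bool).
  by apply: comeagerW (not_forceable_forcesC (Bd n) nsB) => x Bx /Bx.
have c2 : comeager [set x | forall ns : nat * seq bool,
    cylinder ns.2 x -> forces ns.2 (B ns.1) -> B ns.1 x].
  apply: comeager_countable_bigcap => -[n s] /=.
  have [sB|nsB] := pselect (forces s (B n)).
    by apply: comeagerW sB => x Bx /Bx.
  by apply: comeagerW (comeagerT bool).
pose D m : set (seq bool) := [set s | ~ unbounded (potential B E (s :: Os)) \/
  exists2 n, (m <= n)%N & [/\ b n, potential B E Os n & forces s (B n)]].
have c3 : comeager [set x | forall m, visits x (D m)].
  apply: comeager_countable_bigcap => m; apply: comeager_visits => s.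
  have [sE|] := pselect (unbounded (potential B E (s :: Os))); last first.
    by exists [::]; rewrite cats0; left.
  have [n mn [[En nB] bn]] := Eb _ sE m.
  have [|u su] := nB s; first exact: mem_head.
  exists u; right; exists n => //; split=> //; split=> // t tO.
  by apply: nB; rewrite inE tO orbT.
apply: comeagerW (comeagerI c1 (comeagerI c2 c3)) => x [x1 [x2 x3]] xE m.
have [k [[]|[n mn [bn En nB]]]] := x3 m; last first.
  exists n => //; split=> //; split=> //.
  exact: (x2 (n, _) (cylinder_mkseq x k)).
(* The restriction to the neighbourhood [mkseq x k] cannot be bounded: every [n] with [x] in [B n]
   stays in it, since [B n] is forceable from that prefix of [x]. *)
move=> p; have [n pn [[En nB] xn]] := xE p; exists n => //; split=> // s.
rewrite inE => /orP[/eqP -> |]; last exact: nB.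
exact: (x1 (n, _) (cylinder_mkseq x k)).
Qed.

(** * The construction of the pairs *)

Definition splits (b E : set nat) := unbounded (E `&` b) /\ unbounded (E `&` ~` b).

Lemma comeager_unbounded (A : Type) (a : A) (E : set nat) :
  unbounded E -> comeager [set x : nat -> A | unbounded (E `&` [set n | x n = a])].
Proof.
move=> Eunb.
pose D m : set (seq A) := [set s |
  exists n, [/\ (m <= n)%N, E n, (n < size s)%N & nth a s n = a]].
have Dd m : dense_strings (D m).
  move=> s; have [n] := Eunb (maxn m (size s)).
  rewrite geq_max => /andP[mn sn] En; exists (nseq (n - size s).+1 a), n.
  split=> //; first by rewrite size_cat size_nseq addnS ltnS subnKC.
  by rewrite nth_cat ltnNge sn nth_nseq ltnSn.
apply: comeagerW (comeager_countable_bigcap (fun m => comeager_visits (Dd m))).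
move=> x xD m; have [k [n [mn En]]] := xD m; rewrite size_mkseq => nk.
by rewrite nth_mkseq // => xn; exists n.
Qed.

Lemma comeager_splits (E : set nat) :
  unbounded E -> comeager [set x | splits [set n | x n = true] E].
Proof.
move=> Eunb.
apply: comeagerW (comeagerI (comeager_unbounded true Eunb)
                            (comeager_unbounded false Eunb)).
move=> x [xt xf]; split=> // m; have [n mn [En xn]] := xf m.
by exists n => //; split=> //=; rewrite xn.
Qed.

Lemma comeager_nonempty (A : Type) (a0 : A) (G : set (nat -> A)) :
  comeager G -> exists x, G x.
Proof. by move=> /(comeager_in_cylinder a0 [::])[x [Gx _]]; exists x. Qed.

Section Construction.
Variables (J : choiceType) (lt : J -> J -> Prop).
Hypotheses (tc : t_eq_c) (ltwo : strict_well_order lt).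
Hypothesis segJ : forall j, below_continuum (segment lt j).
(** The tasks of stage [j]: a sequence of sets to be split, a set to be decided by the tower, and a
    prescribed prefix of the two reals. The prefixes will make the members of the final cover
    distinct. *)
Variables (B : J -> nat -> set (nat -> bool)) (target : J -> set nat).
Variable start : J -> seq (bool * bool).
Hypothesis Bdecided : forall j n, decided (B j n).

(** The two reals [x_j], [y_j] and the splitting set [b_j]. *)
Local Notation stage := ((nat -> bool) * (nat -> bool) * set nat)%type.
Implicit Types (f : J -> stage) (v : stage) (F : seq J) (Os : seq (seq bool)).

Definition side (c : bool) v : nat -> bool := if c then v.1.1 else v.1.2.

Definition meet_set v : set nat := [set n | v.1.1 n && v.1.2 n].

(** All points come from one side [c]. Splitting is never asked for finite sets mixing the two
    sides, so [x_j] and [y_j] may be tied together by the tower. *)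
Definition hits (i : J) (c : bool) f F Os : set nat :=
  potential (B i) [set n | forall d, d \in F -> B i n (side c (f d))] Os.

Definition below (j : J) F := forall d, d \in F -> lt d j.

Definition keeps_splitting (j : J) f (c : bool) (i : J) (b : set nat) z :=
  forall F Os, below j F ->
  unbounded (hits i c f F Os `&` [set n | B i n z]) ->
  splits b (hits i c f F Os `&` [set n | B i n z]).

(** [spec_splits] starts the new splitting set on the earlier points and [spec_new] extends this to
    the new point; [spec_old] does the same for the earlier splitting sets. A finite set of points
    is thus treated when its last member is added. *)
Record stage_spec (j : J) f v : Prop := StageSpec {
  spec_unbounded : unbounded (meet_set v);
  spec_tower : forall i, lt i j -> subset_star (meet_set v) (meet_set (f i));
  spec_target : subset_star (meet_set v) (target j) \/
                subset_star (meet_set v) (~` target j);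
  spec_start : forall n, (n < size (start j))%N ->
    (v.1.1 n, v.1.2 n) = nth (false, false) (start j) n;
  spec_splits : forall c F Os, below j F -> unbounded (hits j c f F Os) ->
    splits v.2 (hits j c f F Os);
  spec_old : forall c i, lt i j -> keeps_splitting j f c i (f i).2 (side c v);
  spec_new : forall c, keeps_splitting j f c j v.2 (side c v) }.

Lemma eq_hits i c f g F Os :
  (forall d, d \in F -> f d = g d) -> hits i c f F Os = hits i c g F Os.
Proof.
move=> fg; rewrite /hits; congr potential; apply/funext => n; apply/propext.
by split=> H d dF; have := H d dF; rewrite fg.
Qed.

Lemma stage_spec_ext j f g v :
  (forall i, lt i j -> f i = g i) -> stage_spec j f v -> stage_spec j g v.
Proof.
move=> fg [unb tow tar sta spl old new].
have hE i c F Os : below j F -> hits i c g F Os = hits i c f F Os.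
  by move=> Fj; apply/esym/eq_hits => d /Fj/fg.
split=> //.
- by move=> i ij; rewrite -fg //; exact: tow.
- by move=> c F Os Fj; rewrite hE //; exact: spl.
- by move=> c i ij F Os Fj; rewrite hE // -fg //; exact: old.
- by move=> c F Os Fj; rewrite hE //; exact: new.
Qed.

Lemma max_seq F : F != [::] ->
  exists2 m, m \in F & forall d, d \in F -> d = m \/ lt d m.
Proof.
have [irr [tr [tot wf]]] := ltwo.
elim: F => // a [|b F] IH _.
  by exists a; [exact: mem_head|move=> d; rewrite inE => /eqP ->; left].
have [//|m mF mmax] := IH.
have [am|[am|ma]] := tot a m.
- exists m; first by rewrite inE mF orbT.
  by move=> d; rewrite inE => /orP[/eqP ->|/mmax //]; right.
- exists m; first by rewrite inE mF orbT.
  by move=> d; rewrite inE => /orP[/eqP ->|/mmax //]; left.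
- exists a; first exact: mem_head.
  move=> d; rewrite inE => /orP[/eqP ->|/mmax[->|dm]]; [by left|by right|].
  by right; exact: tr ma.
Qed.

(** Compare the largest member [m] of [F] with [i]: the cases [m] below, equal to and above [i] are
    covered by [spec_splits], [spec_new] and [spec_old], the last two applied to [F] without [m]. *)
Lemma stages_split f i c F Os :
  stage_spec i f (f i) -> (forall d, d \in F -> stage_spec d f (f d)) ->
  unbounded (hits i c f F Os) -> splits (f i).2 (hits i c f F Os).
Proof.
have [irr [tr [tot wf]]] := ltwo.
move=> fi fF; have [->|F0] := eqVneq F [::].
  exact: (spec_splits fi).
have [m mF mmax] := max_seq F0.
have [mi|im] := pselect (lt m i).
  by apply: (spec_splits fi) => d /mmax[->|/tr] //; exact.
pose F' := [seq d <- F | d != m].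
have F'm : below m F'.
  by move=> d; rewrite mem_filter => /andP[/eqP dm /mmax[]].
have -> : hits i c f F Os = hits i c f F' Os `&` [set n | B i n (side c (f m))].
  apply/seteqP; split=> n.
    move=> [nF nO]; split; last exact: nF.
    by split=> // d; rewrite mem_filter => /andP[_ /nF].
  move=> [[nF nO] nm]; split=> // d dF; have [->//|dm] := eqVneq d m.
  by apply: nF; rewrite mem_filter dm.
have [//|[e|im']] := tot m i.
  by rewrite e in F'm *; exact: (spec_new fi).
exact: (spec_old (fF m mF)).
Qed.

Lemma segment_additive j : comeager_additive (segment lt j).
Proof.
exact: below_continuum_comeager_additive tc (segment_well_order j ltwo) (segJ j).
Qed.

Lemma below_segment j F :
  below j F -> exists F' : seq (segment lt j), map sval F' = F.
Proof.
elim: F => [|d F IH] Fj; first by exists [::].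
have [|F' <-] := IH; first by move=> e eF; apply: Fj; rewrite inE eF orbT.
have dj : lt d j by apply: Fj; exact: mem_head.
by exists (exist (lt^~ j) d dj :: F').
Qed.

(** There are few enough pairs of a finite sequence below [j] and a finite list of strings for
    additivity to apply. *)
Lemma comeager_below j (A : countType) (a0 : A)
    (G : seq J -> seq (seq bool) -> set (nat -> A)) :
  (forall F Os, below j F -> comeager (G F Os)) ->
  comeager [set x | forall F Os, below j F -> G F Os x].
Proof.
move=> Gc.
have Ka : comeager_additive (seq (segment lt j) * seq (seq bool)).
  apply: comeager_additiveX (@countable_comeager_additive _).
  exact/comeager_additive_seq/segment_additive.
have H (p : seq (segment lt j) * seq (seq bool)) : comeager (G (map sval p.1) p.2).
  suff pj : below j (map sval p.1) by exact: Gc _ p.2 pj.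
  elim: p.1 => [|e F' IH] d //=; rewrite inE => /orP[/eqP ->|/IH //].
  exact: (svalP e).
apply: comeagerW (Ka A a0 _ H) => x xG F Os /below_segment[F' <-].
exact: xG (F', Os).
Qed.

(** Apply preservation to [b] and to its complement. The conclusion for [Os] rests on the hypothesis
    for longer lists, which is why [hits] carries a list of strings throughout the induction. *)
Lemma comeager_keeps_splitting j f c i b :
  (forall F Os, below j F -> unbounded (hits i c f F Os) ->
    splits b (hits i c f F Os)) ->
  comeager (keeps_splitting j f c i b).
Proof.
move=> spl.
pose G F Os : set (nat -> bool) := [set z |
  unbounded (hits i c f F Os `&` [set n | B i n z]) ->
  splits b (hits i c f F Os `&` [set n | B i n z])].
have Gc F Os : below j F -> comeager (G F Os).
  move=> Fj.
  have c1 := comeager_preserves_splitting (Bdecided i)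
    (fun Os' H => (spl F Os' Fj H).1).
  have c2 := comeager_preserves_splitting (Bdecided i)
    (fun Os' H => (spl F Os' Fj H).2).
  apply: comeagerW (comeagerI c1 c2) => z [z1 z2] zunb.
  by split; [exact: z1|exact: z2].
exact: comeagerW (comeager_below false Gc).
Qed.

Lemma unbounded_setIC (E b : set nat) :
  unbounded E -> unbounded (E `&` b) \/ unbounded (E `&` ~` b).
Proof.
move=> Eunb; have [|Eb] := pselect (unbounded (E `&` b)); first by left.
right=> m; move/existsNP : Eb => [p pE].
have [n] := Eunb (maxn m p); rewrite geq_max => /andP[mn pn] En.
by exists n => //; split=> // bn; apply: pE; exists n.
Qed.

Lemma exists_tower_next j f :
  (forall i, lt i j -> stage_spec i f (f i)) ->
  exists t, [/\ unbounded t, forall i, lt i j -> subset_star t (meet_set (f i)),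
    subset_star t (target j) \/ subset_star t (~` target j) &
    forall n, (n < size (start j))%N -> t n].
Proof.
move=> fj.
have [||t [tunb tf]] := tower_lower_bound (a := fun i => meet_set (f (sval i))) tc
    (segment_well_order j ltwo) (segJ j).
- by move=> [i ij]; exact: spec_unbounded (fj i ij).
- by move=> [i ij] [k kj] ik; exact: spec_tower (fj k kj) _ ik.
have [u [uunb ut udec]] : exists u, [/\ unbounded u, u `<=` t &
    subset_star u (target j) \/ subset_star u (~` target j)].
  have [H|H] := unbounded_setIC (target j) tunb; eexists; split; try exact: H.
  - by move=> n [].
  - by left; apply/subset_starP; exists 0%N => n _ [].
  - by move=> n [].
  - by right; apply/subset_starP; exists 0%N => n _ [].
(* Adding the numbers below [k] changes nothing modulo finite sets and leaves the prefix [start j]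
   unconstrained by the tower. *)
pose k := size (start j).
have uk (a : set nat) : subset_star u a -> subset_star (u `|` [set n | (n < k)%N]) a.
  move=> /subset_starP[m ma]; apply/subset_starP; exists (maxn m k) => n.
  by rewrite geq_max => /andP[mn kn] [/(ma n mn)//|/=]; rewrite ltnNge kn.
exists (u `|` [set n | (n < k)%N]); split.
- by move=> m; have [n mn un] := uunb m; exists n => //; left.
- move=> i ij; apply: uk; apply: subset_star_trans (tf (exist _ i ij)).
  by apply/subset_starP; exists 0%N => n _ /ut.
- by case: udec => H; [left|right]; exact: uk.
- by right.
Qed.

(** A Cohen real splits any one infinite set, so by additivity it splits all those required before
    stage [j], for both sides at once. *)
Lemma exists_splitting j f : exists b : set nat,
  forall c F Os, below j F -> unbounded (hits j c f F Os) ->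
  splits b (hits j c f F Os).
Proof.
have H c : comeager [set x | forall F Os, below j F ->
    unbounded (hits j c f F Os) -> splits [set n | x n = true] (hits j c f F Os)].
  pose G F Os : set (nat -> bool) := [set x |
    unbounded (hits j c f F Os) -> splits [set n | x n = true] (hits j c f F Os)].
  apply: (@comeager_below j _ false G) => F Os _.
  have [Eunb|nunb] := pselect (unbounded (hits j c f F Os)).
    by apply: comeagerW (comeager_splits Eunb) => x xs _.
  by apply: comeagerW (comeagerT bool) => x _ /nunb.
have [x xH] := comeager_nonempty false (comeager_countable_bigcap H).
by exists [set n | x n = true].
Qed.

Lemma stage_step j f :
  (forall i, lt i j -> stage_spec i f (f i)) -> exists v, stage_spec j f v.
Proof.
move=> fj.
have [b bP] := exists_splitting j f.
have [t [tunb ttow ttar tstart]] := exists_tower_next fj.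
have oldc c : comeager
    [set z | forall i, lt i j -> keeps_splitting j f c i (f i).2 z].
  have H (i : segment lt j) : comeager (keeps_splitting j f c (sval i) (f (sval i)).2).
    apply: comeager_keeps_splitting => F Os Fj; apply: stages_split.
      exact: fj (svalP i).
    by move=> d /Fj/fj.
  have := segment_additive false H.
  by apply: comeagerW => z zH i ij; exact: zH (exist _ i ij).
have newc c : comeager (keeps_splitting j f c j b).
  by apply: comeager_keeps_splitting => F Os; exact: bP.
(* From a pair, [phi true] reads off [x n], and [phi false] reads off [y n], suppressed where [x n]
   holds outside [t]; so the meet lies in [t]. Each map alone is onto, hence each real by itself is
   as generic as wanted. *)
pose phi (c : bool) n (p : bool * bool) :=
  if c then p.1 else p.2 && (`[< t n >] || ~~ p.1).
have phisurj c n a : exists p, phi c n p = a.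
  by case: c; [exists (a, false)|exists (false, a)]; rewrite //= orbT andbT.
have sidec c : comeager [set g : nat -> bool * bool |
    (forall i, lt i j -> keeps_splitting j f c i (f i).2 (fun n => phi c n (g n)))
    /\ keeps_splitting j f c j b (fun n => phi c n (g n))].
  exact: (comeager_preimage (false, false) (phisurj c) (comeagerI (oldc c) (newc c))).
(* The value [(true, true)] taken infinitely often on [t] keeps the meet infinite; the cylinder
   imposes the prescribed prefix. *)
have [g [[gc gt] gstart]] := comeager_in_cylinder (false, false) (start j)
  (comeagerI (comeager_countable_bigcap sidec) (comeager_unbounded (true, true) tunb)).
pose v : stage := ((fun n => phi true n (g n)), (fun n => phi false n (g n)), b).
have sideE c : side c v = (fun n => phi c n (g n)) by case: c.
have vt : meet_set v `<=` t.
  by move=> n; rewrite /meet_set /= => /andP[-> /andP[_]]; rewrite orbF => /asboolP.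
have vstar a : subset_star t a -> subset_star (meet_set v) a.
  by apply: subset_star_trans; apply/subset_starP; exists 0%N => n _ /vt.
exists v; split.
- move=> m; have [n mn [tn gn]] := gt m; exists n => //.
  by rewrite /meet_set /= gn /= asboolT.
- by move=> i ij; apply/vstar/ttow.
- by case: ttar => H; [left|right]; exact: vstar.
- move=> n nj /=; rewrite asboolT /= ?andbT; last exact: tstart.
  by rewrite -gstart nth_mkseq //; case: (g n).
- exact: bP.
- by move=> c i ij; rewrite sideE; exact: (gc c).1.
- by move=> c; rewrite sideE; exact: (gc c).2.
Qed.

Lemma exists_stages : exists f, forall j, stage_spec j f (f j).
Proof.
have [irr [tr [tot wf]]] := ltwo.
have v0 : stage := (fun=> false, fun=> false, set0).
exact: (wf_dependent_choice v0 wf stage_spec_ext stage_step).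
Qed.

End Construction.

(** * Splitting countable Borel covers *)

Lemma embeds_surjection (T U : Type) (t0 : T) :
  embeds T U -> exists e : U -> T, forall t, exists u, e u = t.
Proof.
move=> [f finj].
have /choice[e eP] : forall u, exists t, (exists t', f t' = u) -> f t = u.
  move=> u; have [[t tu]|no] := pselect (exists t', f t' = u); first by exists t.
  by exists t0 => /no.
by exists e => t; exists (f t); apply: finj; apply: eP; exists t.
Qed.

(** A triple becomes one subset of a disjoint sum: the graph of the labels, the set itself, and a
    singleton. *)
Lemma tasks_embed :
  embeds (borel_code * set nat * seq (bool * bool)) (set nat).
Proof.
apply: embeds_trans (embeds_set_countable
  (seq nat * nat + (nat + seq (bool * bool)))%type).
exists (fun (p : borel_code * set nat * seq (bool * bool)) z => match z with
  | inl (q, n) => labels p.1.1 q = n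
  | inr (inl n) => p.1.2 n
  | inr (inr s) => p.2 = s end) => -[[c a] s] [[d b] t] e.
have E z := congr1 (@^~ z) e; congr (_, _, _).
- apply: labels_inj; apply/funext => q; have /= := E (inl (q, labels d q)).
  by move=> ->.
- by apply/funext => n; exact: (E (inr (inl n))).
- by have /= := E (inr (inr t)) => ->.
Qed.

Definition common (p : cantor_space * cantor_space) : set nat :=
  [set n | p.1 n && p.2 n].

Definition finite_splitting (X : set cantor_space) :=
  forall B : nat -> set cantor_space,
  (forall n, <<s @open cantor_space >> (B n)) ->
  exists b : set nat, forall F, F `<=` X -> finite_set F ->
    unbounded [set n | F `<=` B n] -> splits b [set n | F `<=` B n].

Lemma finite_subset_range (T : choiceType) (J : choiceType) (z : J -> T)
    (F : set T) :
  F `<=` range z -> finite_set F -> exists s : seq J, F = [set z j | j in [set` s]].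
Proof.
move=> + /finite_seqP[l Fl]; rewrite {}Fl; elim: l => [|p l IH] lz.
  exists [::]; apply/seteqP; split=> // x [] //.
have [j _ jp] : range z p by apply: lz; exact: mem_head.
have [|s sP] := IH; first by move=> x xl; apply: lz; rewrite /= inE xl orbT.
exists (j :: s); apply/seteqP; split=> x /=.
  rewrite inE => /orP[/eqP ->|xl]; first by exists j; [exact: mem_head|].
  have : [set z j | j in [set` s]] x by rewrite -sP.
  by move=> [k ks <-]; exists k => //=; rewrite inE ks orbT.
move=> [k]; rewrite inE => /orP[/eqP -> <-|ks <-]; first by rewrite jp mem_head.
rewrite inE; apply/orP; right.
have : [set z j | j in [set` s]] (z k) by exists k.
by rewrite -sP.
Qed.

(** The tasks are listed along [J] by a surjection, so each of them is handled at some stage. The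
    splitting set of a stage serves both sides, hence the last clause has one [b] for all single
    points of either side. *)
Lemma exists_generic_pairs : t_eq_c ->
  exists (J : Type) (lt : J -> J -> Prop) (z : bool -> J -> cantor_space),
  let t j := common (z true j, z false j) in
  [/\ forall i j, lt i j \/ i = j \/ lt j i,
      forall j, unbounded (t j) /\ forall i, lt i j -> subset_star (t j) (t i),
      forall s, exists j, subset_star (t j) s \/ subset_star (t j) (~` s),
      forall s : seq (bool * bool), exists j, forall n, (n < size s)%N ->
        (z true j n, z false j n) = nth (false, false) s n &
      (forall c, finite_splitting (range (z c))) /\
      forall B : nat -> set cantor_space,
        (forall n, <<s @open cantor_space >> (B n)) ->
        exists b : set nat, forall c x, range (z c) x ->
          unbounded [set n | B n x] -> splits b [set n | B n x]].
Proof.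
move=> tc.
have [J [lt [ltwo cJ segJ]]] := exists_continuum_order.
have [e eP] := embeds_surjection (UnionCode (fun=> BaseCode [::]), set0, [::])
  (embeds_trans tasks_embed cJ).
(* A union code is read as the sequence of its parts, any other code as the constant sequence of the
   whole space. *)
pose B j n := denote (if (e j).1.1 is UnionCode f then f n else BaseCode [::]).
have Bd j n : decided (B j n) by exact: decided_denote.
have [f fP] := exists_stages tc ltwo segJ (fun j => (e j).1.2) (fun j => (e j).2) Bd.
pose z c j : cantor_space := side c (f j).
have Bsplit (C : nat -> set cantor_space) :
    (forall n, <<s @open cantor_space >> (C n)) ->
    exists b : set nat, forall c (F : seq J),
      let E := [set n | forall d, d \in F -> C n (z c d)] in
      unbounded E -> splits b E.
  move=> Cb; have /choice[g gP] : forall n, exists c, C n = denote c.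
    by move=> n; exact: borel_denote.
  have [i iE] := eP (UnionCode g, set0, [::]).
  have BC n : B i n = C n by rewrite /B iE /= gP.
  exists (f i).2 => c F E.
  have := @stages_split J lt ltwo B _ _ f i c F [::] (fP i) (fun d _ => fP d).
  have -> // : hits B i c f F [::] = E.
  apply/seteqP; split=> n.
    by move=> [nF _] d dF; rewrite -BC; exact: nF.
  by move=> nE; split=> // d dF; rewrite BC; exact: nE.
exists J, lt, z; split.
- by have [_ [_ []]] := ltwo.
- move=> j; split; first exact: spec_unbounded (fP j).
  exact: spec_tower (fP j).
- move=> s; have [j jE] := eP (BaseCode [::], s, [::]); exists j.
  by have := spec_target (fP j); rewrite jE.
- move=> s; have [j jE] := eP (BaseCode [::], set0, s); exists j.
  by have := spec_start (fP j); rewrite jE.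
split.
  move=> c C /Bsplit[b bP]; exists b => F Fz Ffin.
  have [s ->] := finite_subset_range Fz Ffin.
  have -> : [set n | [set z c j | j in [set` s]] `<=` C n] =
      [set n | forall d, d \in s -> C n (z c d)].
    apply/seteqP; split=> n H; first by move=> d ds; apply: H; exists d.
    by move=> _ [d ds <-]; exact: H.
  exact: bP.
move=> C /Bsplit[b bP]; exists b => c _ [j _ <-].
have -> : [set n | C n (z c j)] = [set n | forall d, d \in [:: j] -> C n (z c d)].
  apply/seteqP; split=> n H; first by move=> d; rewrite inE => /eqP ->.
  by apply: H; exact: mem_head.
exact: bP.
Qed.

Section BorelCovers.
Variables (X : set cantor_space) (U : set (set cantor_space)).

(** Filling the other indices with the empty set makes the [n] with [x] in [B n] exactly the codes
    of the members containing [x], for [x] in [X]. *)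
Lemma borel_cover_enum :
  countable U -> (forall A, U A -> borel_in X A) ->
  exists (g : set cantor_space -> nat) (B : nat -> set cantor_space),
  [/\ {in U &, injective g}, forall n, <<s @open cantor_space >> (B n),
      forall A, U A -> A = X `&` B (g A) &
      forall n, ~ (exists2 A, U A & g A = n) -> B n = set0].
Proof.
move=> /countable_injP[g ginj] Ub; exists g.
have /choice[B BP] : forall n, exists B, [/\ <<s @open cantor_space >> B,
    forall A, U A -> g A = n -> A = X `&` B &
    ~ (exists2 A, U A & g A = n) -> B = set0].
  move=> n; have [[A UA gA]|no] := pselect (exists2 A, U A & g A = n).
    have [B [Bb AB]] := Ub A UA; exists B; split=> //.
      by move=> A' UA' gA'; rewrite -AB; apply: ginj; rewrite ?inE // gA.
    by case; exists A.
  exists set0; split=> //; last by move=> A UA gA; case: no; exists A.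
  by have [] := smallest_sigma_algebra [set: cantor_space] (@open cantor_space).
exists B; split=> //.
- by move=> n; have [] := BP n.
- by move=> A UA; have [_ + _] := BP (g A); apply.
- by move=> n; have [] := BP n.
Qed.

End BorelCovers.

Lemma sub_is_cover (T : topologicalType) (X : set T) (U V : set (set T)) :
  V `<=` U -> is_cover X U -> (forall x, X x -> exists A, V A /\ A x) ->
  is_cover X V.
Proof.
by move=> VU [UX [_ Unot]] cov; split=> [A /VU/UX|]; last split=> // A /VU/Unot.
Qed.

Lemma infinite_image_inj (T V : Type) (g : T -> V) (S : set T) :
  {in S &, injective g} -> infinite_set S -> infinite_set (g @` S).
Proof.
by move=> ginj Sinf Sfin; apply: Sinf; rewrite -(eq_finite_set (inj_card_eq ginj)).
Qed.

(** The two parts consist of the members whose code lies in [b] and outside [b]. *)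
Lemma Split_B_Lambda (X : set cantor_space) :
  (forall B : nat -> set cantor_space,
    (forall n, <<s @open cantor_space >> (B n)) ->
    exists b : set nat, forall x, X x ->
      unbounded [set n | B n x] -> splits b [set n | B n x]) ->
  Split_prop B_Lambda B_Lambda X.
Proof.
move=> Xsplit U [Uc [Ub [Ucov Ularge]]].
have [g [B [ginj Bb UB B0]]] := borel_cover_enum Uc Ub.
have [b bP] := Xsplit B Bb.
have BE x : X x -> [set n | B n x] = g @` [set A | U A /\ A x].
  move=> Xx; apply/seteqP; split=> [n Bn|_ [A [UA Ax] <-]]; last first.
    by move: Ax; rewrite /= {1}(UB A UA) => -[].
  have [[A UA gA]|/B0 e] := pselect (exists2 A, U A & g A = n).
    by exists A => //; split=> //; rewrite (UB A UA) gA.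
  by rewrite /mkset e in Bn.
have part (c : set nat) : (forall x, X x -> unbounded ([set n | B n x] `&` c)) ->
    B_Lambda X [set A | U A /\ c (g A)].
  move=> cP.
  have inf x : X x -> infinite_set [set A | (U A /\ c (g A)) /\ A x].
    move=> Xx /(finite_image g); apply/infinite_natP => m.
    have [n mn [Bn cn]] := cP x Xx m; exists n => //.
    have : (g @` [set A | U A /\ A x]) n by rewrite -BE.
    by move=> [A [UA Ax] gA]; exists A => //=; rewrite gA.
  split; first by apply: sub_countable Uc; apply: subset_card_le => A [].
  split; first by move=> A [/Ub].
  split=> //; apply: sub_is_cover Ucov _ => [A []//|x Xx].
  by have /infinite_setN0[A] := inf x Xx; exists A.
have Xb x : X x -> splits b [set n | B n x].
  move=> Xx; apply: bP => //; rewrite BE //; apply/infinite_natP.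
  apply: infinite_image_inj (Ularge x Xx) => A A'; rewrite !inE => -[UA _] [UA' _].
  by apply: ginj; rewrite inE.
exists [set A | U A /\ b (g A)], [set A | U A /\ (~` b) (g A)]; split.
  apply/seteqP; split=> A; first by case=> -[].
  by move=> UA; have [bA|nbA] := pselect (b (g A)); [left|right].
split; first by apply/seteqP; split=> // A [[_ ?] [_ []]].
split; [exists [set A | U A /\ b (g A)]|exists [set A | U A /\ (~` b) (g A)]];
  split=> //.
- by apply: part => x /Xb[].
- by apply: (part (~` b)) => x /Xb[].
Qed.

Lemma Split_B_Omega (X : set cantor_space) :
  finite_splitting X -> Split_prop B_Omega B_Omega X.
Proof.
move=> Xsplit U [Uc [Ub [Ucov Uomega]]].
have [g [B [ginj Bb UB B0]]] := borel_cover_enum Uc Ub.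
have [b bP] := Xsplit B Bb.
(* [X] has a point because the members of the cover are proper. Adding it to a finite set avoids the
   empty set, which is also contained in the filler sets [B n]. *)
have [x0 Xx0] : X !=set0.
  have [//|A [UA _]] := Uomega set0 _ (finite_set0 _).
  by have /existsNP[x /not_implyP[Xx _]] := Ucov.2.2 A UA; exists x.
have BE F : F !=set0 -> F `<=` X ->
    [set n | F `<=` B n] = g @` [set A | U A /\ F `<=` A].
  move=> [y Fy] FX; apply/seteqP; split=> [n Bn|_ [A [UA FA] <-]]; last first.
    by move=> x /FA; rewrite {1}(UB A UA) => -[].
  have [[A UA gA]|/B0 e] := pselect (exists2 A, U A & g A = n).
    exists A => //; split=> // x Fx; rewrite (UB A UA) gA.
    by split; [exact: FX|exact: Bn].
  by have := Bn y Fy; rewrite e.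
(* If only finitely many members contained [F], adding to [F] a point missed by each of them would
   give a finite set contained in no member. *)
have inf F : F `<=` X -> finite_set F -> infinite_set [set A | U A /\ F `<=` A].
  move=> FX Ffin Sfin.
  have /choice[p pP] : forall A, exists x, U A -> X x /\ ~ A x.
    move=> A; have [UA|] := pselect (U A); last by exists x0.
    by have /existsNP[x /not_implyP Hx] := Ucov.2.2 A UA; exists x.
  have [||A [UA FA]] := Uomega (F `|` p @` [set A | U A /\ F `<=` A]).
  - by move=> x [/FX //|[A [UA _] <-]]; exact: (pP A UA).1.
  - by rewrite finite_setU; split=> //; exact: finite_image.
  have FA' : F `<=` A by move=> x Fx; apply: FA; left.
  by apply: (pP A UA).2; apply: FA; right; exists A.
have Xb F : F !=set0 -> F `<=` X -> finite_set F -> splits b [set n | F `<=` B n].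
  move=> F0 FX Ffin; apply: bP => //; rewrite BE //; apply/infinite_natP.
  apply: infinite_image_inj (inf F FX Ffin) => A A'; rewrite !inE.
  by move=> -[UA _] [UA' _]; apply: ginj; rewrite inE.
have part (c : set nat) : (forall F, F !=set0 -> F `<=` X -> finite_set F ->
    unbounded ([set n | F `<=` B n] `&` c)) -> B_Omega X [set A | U A /\ c (g A)].
  move=> cP.
  have om F : F `<=` X -> finite_set F ->
      exists A, (U A /\ c (g A)) /\ F `<=` A.
    move=> FX Ffin; have F0 : (F `|` [set x0]) !=set0 by exists x0; right.
    have FX' : F `|` [set x0] `<=` X by move=> x [/FX|->].
    have [|n _ [Bn cn]] := cP _ F0 FX' _ 0%N.
      by rewrite finite_setU; split=> //; exact: finite_set1.
    have : (g @` [set A | U A /\ F `|` [set x0] `<=` A]) n by rewrite -BE.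
    move=> [A [UA FA] gA]; exists A; split; first by rewrite gA.
    by move=> x Fx; apply: FA; left.
  split; first by apply: sub_countable Uc; apply: subset_card_le => A [].
  split; first by move=> A [/Ub].
  split=> //; apply: sub_is_cover Ucov _ => [A []//|x Xx].
  have [||A [VA xA]] := om [set x]; [by move=> _ ->|exact: finite_set1|].
  by exists A; split=> //; exact: xA.
exists [set A | U A /\ b (g A)], [set A | U A /\ (~` b) (g A)]; split.
  apply/seteqP; split=> A; first by case=> -[].
  by move=> UA; have [bA|nbA] := pselect (b (g A)); [left|right].
split; first by apply/seteqP; split=> // A [[_ ?] [_ []]].
split; [exists [set A | U A /\ b (g A)]|exists [set A | U A /\ (~` b) (g A)]];
  split=> //.
- by apply: part => F F0 FX Ffin; exact: (Xb F F0 FX Ffin).1.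
- by apply: (part (~` b)) => F F0 FX Ffin; exact: (Xb F F0 FX Ffin).2.
Qed.

(** * The cover by common elements *)

Definition common_set (X : set (cantor_space * cantor_space)) (n : nat) :
  set (cantor_space * cantor_space) := X `&` [set p | common p n].

Lemma open_coordinate n (a : bool) : open [set x : cantor_space | x n = a].
Proof.
have cont : continuous (fun x : cantor_space => x n : bool).
  exact: (@proj_continuous nat (fun=> bool : topologicalType) n).
by apply: (@open_comp _ _ _ [set a]) => [x _|]; [exact: cont|exact: discrete_open].
Qed.

Lemma clopen_common_set X n : clopen_in X (common_set X n).
Proof.
have fst_open a : open [set p : cantor_space * cantor_space | p.1 n = a].
  by apply: (@open_comp _ _ fst) (open_coordinate n a) => p _; exact: cvg_fst.
have snd_open a : open [set p : cantor_space * cantor_space | p.2 n = a].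
  by apply: (@open_comp _ _ snd) (open_coordinate n a) => p _; exact: cvg_snd.
split.
  exists ([set p | p.1 n = true] `&` [set p | p.2 n = true]); split.
    exact: openI.
  by congr (X `&` _); apply/seteqP; split=> p /andP.
exists ([set p | p.1 n = false] `|` [set p | p.2 n = false]); split.
  exact: openU.
apply/seteqP; split=> p [Xp].
  move=> np; split=> //; apply: contrapT => no; apply: np; split=> //.
  by apply/andP; split; apply: contrapT => /negP/negbTE ?; apply: no; [left|right].
by move=> np; split=> // -[_ /andP[/= p1 p2]]; case: np; rewrite /= ?p1 ?p2.
Qed.

Section CommonCover.
Variable X : set (cantor_space * cantor_space).
(** This makes the sets [common_set X n] pairwise distinct and different from [X]. *)
Hypothesis sep : forall n k, n <> k ->
  exists p, [/\ X p, common p n & ~ common p k].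
Hypothesis unb : forall p, X p -> unbounded (common p).

Local Notation U := (range (common_set X)).

Lemma common_set_inj : injective (common_set X).
Proof.
move=> n k e; apply: contrapT => /sep[p [Xp pn pk]]; apply: pk.
by have [] : common_set X k p by rewrite -e.
Qed.

Lemma common_cover : is_cover X U.
Proof.
split; first by move=> _ [n _ <-] p [].
split=> [p Xp|_ [n _ <-] XU].
  by have [n _ pn] := unb Xp 0%N; exists (common_set X n); split=> //; exists n.
have [p [Xp _]] := sep (nesym (n_Sn n)).
by case: (XU p Xp).
Qed.

Lemma common_cover_large : large_cover X U.
Proof.
split; first exact: common_cover.
move=> p Xp; have -> : [set A | U A /\ A p] = common_set X @` common p.
  apply/seteqP; split=> [_ [[n _ <-] [_ pn]]|_ [n pn <-]]; first by exists n.
  by split=> //; exists n.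
apply: infinite_image_inj; last exact/infinite_natP/unb.
by move=> n k _ _; exact: common_set_inj.
Qed.

Lemma countable_common_cover : countable U.
Proof. exact: card_image_le. Qed.

Lemma clopen_common_cover A : U A -> clopen_in X A.
Proof. by move=> [n _ <-]; exact: clopen_common_set. Qed.

(** Refine [common p] to its trace on a tower element almost contained in it. The trace agrees with
    that element up to a finite set, so the traces inherit the linear order of the tower. *)
Lemma common_cover_tau_star (J : Type) (t : J -> set nat) :
  (forall j, unbounded (t j)) ->
  (forall i j, subset_star (t i) (t j) \/ subset_star (t j) (t i)) ->
  (forall p, X p -> exists j, subset_star (t j) (common p)) ->
  C_Tstar X U.
Proof.
move=> tunb ttot tX; split; first exact: countable_common_cover.
split; first exact: clopen_common_cover.
split; first exact: common_cover.
exists setT, (common_set X); split; first by move=> n m _ _; exact: common_set_inj.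
split=> //.
have hE p : X p -> [set n | setT n /\ common_set X n p] = common p.
  by move=> Xp; apply/seteqP; split=> n; [move=> [_ []]|].
split; first by move=> p Xp; rewrite hE //; exact/infinite_natP/unb.
have /choice[r rP] : forall y : set nat, exists z,
    (exists2 p, X p & common p = y) -> [/\ z `<=` y, unbounded z &
      exists j, subset_star z (t j) /\ subset_star (t j) z].
  move=> y; have [[p Xp py]|no] := pselect (exists2 p, X p & common p = y); last first.
    by exists set0 => /no.
  have [j jp] := tX p Xp; exists (t j `&` y) => _.
  have jy : subset_star (t j) (t j `&` y).
    move: jp; rewrite py => /subset_starP[m mP]; apply/subset_starP.
    by exists m => n mn tn; split=> //; exact: mP.
  split; first by move=> n [].
    move=> m; have /subset_starP[k kP] := jy.
    have [n] := tunb j (maxn m k); rewrite geq_max => /andP[mn kn] tn.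
    by exists n => //; exact: kP.
  by exists j; split=> //; apply/subset_starP; exists 0%N => n _ [].
have YE y : [set [set n | setT n /\ common_set X n x] | x in X] y ->
    exists2 p, X p & common p = y.
  by move=> [p Xp <-]; exists p => //; rewrite hE.
exists r; split.
  by move=> y /YE/rP[ry runb _]; split=> //; exact/infinite_natP.
move=> y z /YE/rP[_ _ [i [yi iy]]] /YE/rP[_ _ [j [zj jz]]].
have [ij|ji] := ttot i j; [left|right].
  exact: subset_star_trans yi (subset_star_trans ij jz).
exact: subset_star_trans zj (subset_star_trans ji iy).
Qed.

Lemma common_cover_tau :
  (forall p q, X p -> X q ->
    subset_star (common p) (common q) \/ subset_star (common q) (common p)) ->
  C_T X U.
Proof.
move=> tot; split; first exact: countable_common_cover.
split; first exact: clopen_common_cover.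
split; first exact: common_cover_large.
have fin p q : X p -> X q -> subset_star (common p) (common q) ->
    finite_set [set A | U A /\ A p /\ ~ A q].
  move=> Xp Xq /(finite_image (common_set X)); apply: sub_finite_set.
  move=> _ [[n _ <-] [[_ pn] nq]]; exists n => //; split=> // qn.
  exact: nq.
by move=> p q Xp Xq; have [H|H] := tot p q Xp Xq; [left|right]; exact: fin.
Qed.

(** A partition of the cover amounts to a set [s] of indices. A point whose [common] is almost
    inside [s] or its complement lies in only finitely many members of the opposite part, which then
    contains no large cover. *)
Lemma common_cover_no_split
    (P Q : set (cantor_space * cantor_space) ->
           set (set (cantor_space * cantor_space)) -> Prop) :
  P X U -> (forall V, Q X V -> large_cover X V) ->
  (forall s, exists2 p, X p &
    subset_star (common p) s \/ subset_star (common p) (~` s)) ->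
  ~ Split_prop P Q X.
Proof.
move=> PU Qlarge reaping /(_ _ PU)[V [W [VW [VW0 [[V' [V'V QV']] [W' [W'W QW']]]]]]].
have small (s : set nat) Z p : X p -> (forall n, Z (common_set X n) -> ~ s n) ->
    Z `<=` U -> subset_star (common p) s -> large_cover X Z -> False.
  move=> Xp Zs ZU pfin [_ Zlarge]; apply: (Zlarge p Xp).
  apply: sub_finite_set (finite_image (common_set X) pfin) => A [ZA Ap].
  have [n _ nA] := ZU A ZA; exists n => //.
  by move: ZA Ap; rewrite -nA => /Zs sn [].
have [p Xp [H|H]] := reaping [set n | V (common_set X n)].
- apply: (small _ W' p Xp _ _ H (Qlarge _ QW')).
    move=> n /W'W Wn Vn.
    by have : (V `&` W) (common_set X n) by []; rewrite VW0.
  by move=> A /W'W WA; rewrite -VW; right.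
- apply: (small _ V' p Xp _ _ H (Qlarge _ QV')).
    by move=> n /V'V Vn; apply.
  by move=> A /V'V VA; rewrite -VW; left.
Qed.

End CommonCover.

(** * The two sets, their union and their products *)

Theorem theorem8p3 :
  t_eq_c ->
  exists L0 L1 : set cantor_space,
    L0 `<=` infinite_subsets /\ L1 `<=` infinite_subsets /\
    (* (1) *)
    (Split_prop B_Omega B_Omega L0 /\ Split_prop B_Lambda B_Lambda L0) /\
    (Split_prop B_Omega B_Omega L1 /\ Split_prop B_Lambda B_Lambda L1) /\
    (* (2) *)
    Split_prop B_Lambda B_Lambda (L0 `|` L1) /\
    (* (3) *)
    ~ Split_prop C_Tstar C_Lambda (L0 `*` L1) /\
    ~ Split_prop C_Tstar C_Lambda ((L0 `|` L1) `*` (L0 `|` L1)) /\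
    (* (4) *)
    (exists Y : set (cantor_space * cantor_space),
        Y `<=` L0 `*` L1 /\ ~ Split_prop C_T C_T Y).
Proof.
move=> tc.
have [J [lt [z [tot zdec zreap zstart [zfin zpt]]]]] := exists_generic_pairs tc.
set t := fun j => common (z true j, z false j) in zdec zreap.
pose L c := range (z c).
have LL c : L c `<=` L true `|` L false by case: c => x Lx; [left|right].
have ttot i j : subset_star (t i) (t j) \/ subset_star (t j) (t i).
  have [ij|[->|ji]] := tot i j.
  - by right; apply: (zdec j).2.
  - by left; rewrite /subset_star setDv; exact: finite_set0.
  - by left; apply: (zdec i).2.
have tz c j : t j `<=` [set n | z c j n] by case: c => n /andP[].
have tunb j : unbounded (t j) := (zdec j).1.
have LLP x : (L true `|` L false) x -> exists j, t j `<=` [set n | x n].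
  by move=> [] [j _ <-]; exists j; exact: tz.
(* Of the two tower elements below the coordinates, the later one is almost contained in both
   coordinates. *)
have tLL p : ((L true `|` L false) `*` (L true `|` L false)) p ->
    exists j, subset_star (t j) (common p).
  move=> [/LLP[i ip] /LLP[j jp]].
  have [H|H] := ttot i j; [exists i|exists j]; move/subset_starP: H => [m mP];
    apply/subset_starP; exists m => n mn tn; apply/andP.
    by split; [exact: ip|apply/jp/mP].
  by split; [apply/ip/mP|exact: jp].
have unbLL p : ((L true `|` L false) `*` (L true `|` L false)) p ->
    unbounded (common p).
  move=> /tLL[j /subset_starP[m mP]] k.
  have [n] := tunb j (maxn k m); rewrite geq_max => /andP[kn mn] tn.
  by exists n => //; exact: mP.
(* On this diagonal the sets [common p] are the tower elements themselves, which gives a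
   tau-cover. *)
pose Y := [set p | exists j, p = (z true j, z false j)].
have YL01 : Y `<=` L true `*` L false by move=> _ [j ->]; split; exists j.
have L01LL : L true `*` L false `<=` (L true `|` L false) `*` (L true `|` L false).
  by move=> p [p1 p2]; split; [left|right].
have sep n k : n <> k -> exists p, [/\ Y p, common p n & ~ common p k].
  (* Up to [n + k] both reals of the pair are prescribed to be the indicator of [n]. *)
  move=> nk; pose s := mkseq (fun i => (i == n, i == n)) (n + k).+1.
  have [j jP] := zstart s; exists (z true j, z false j).
  have sE i : (i <= n + k)%N -> (z true j i, z false j i) = (i == n, i == n).
    by move=> ik; rewrite jP ?size_mkseq // nth_mkseq.
  have := sE n (leq_addr _ _); rewrite eqxx => -[n1 n2].
  have := sE k (leq_addl _ _); have /eqP/negbTE -> := nesym nk => -[k1 k2].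
  by split; [exists j|rewrite /common /= n1 n2|rewrite /common /= k1].
have reap s : exists2 p, Y p &
    subset_star (common p) s \/ subset_star (common p) (~` s).
  by have [j jP] := zreap s; exists (z true j, z false j) => //; exists j.
(* Both products lie between the diagonal [Y], which supplies separation and reaping, and the square
   of the union, on which the tower refines the cover. *)
have noTstar X : Y `<=` X -> X `<=` (L true `|` L false) `*` (L true `|` L false) ->
    ~ Split_prop C_Tstar C_Lambda X.
  move=> YX XLL.
  have Xsep n k : n <> k -> exists p, [/\ X p, common p n & ~ common p k].
    by move=> /sep[p [/YX]]; exists p.
  have Xunb p : X p -> unbounded (common p) by move=> /XLL/unbLL.
  apply: common_cover_no_split.
  - by apply: (common_cover_tau_star Xsep Xunb tunb ttot) => p /XLL/tLL.
  - by move=> V [_ []].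
  - by move=> s; have [p /YX] := reap s; exists p.
have Linf c : L c `<=` infinite_subsets.
  move=> _ [j _ <-]; apply/infinite_natP => m; have [n mn tn] := tunb j m.
  by exists n => //; exact: tz tn.
have Lsplit X : X `<=` L true `|` L false -> Split_prop B_Lambda B_Lambda X.
  move=> XLL; apply: Split_B_Lambda => B /zpt[b bP]; exists b => x /XLL.
  by case; exact: bP.
exists (L true), (L false); do 2!(split; first exact: Linf).
split; first by split; [exact/Split_B_Omega/zfin|exact: Lsplit (LL true)].
split; first by split; [exact/Split_B_Omega/zfin|exact: Lsplit (LL false)].
split; first exact: Lsplit.
split; first exact: noTstar.
split; first by apply: noTstar => // p /YL01/L01LL.
exists Y; split=> //; apply: common_cover_no_split.
- apply: common_cover_tau => //; first by move=> p /YL01/L01LL/unbLL.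
  by move=> _ _ [i ->] [j ->]; exact: ttot.
- by move=> V [_ [_ []]].
- exact: reap.
Qed.
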